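(* Let $r\geq 2$ be an integer. The space $ZR(\mathbf{Z}^r)$ of additive preorders on $\mathbf{Z}^r$ is quasi-compact. It contains as a closed subset the space of additive orders on $\mathbf{Z}^r$ (with the induced topology), which is homeomorphic to the Cantor set.
   Context: Let $M=\mathbf{Z}^r\subset\mathbf{R}^r$, let $N=\mathrm{Hom}_{\mathbf{Z}}(M,\mathbf{Z})$ be its dual, and let $N_{\mathbf{R}}$ be the dual space of $\mathbf{R}^r$, containing the lattice $N$; write $\langle u,v\rangle=v(u)$ for $u\in\mathbf{R}^r$, $v\in N_{\mathbf{R}}$. A preorder on $M$ is a binary relation $\preceq$ such that for all $m,n,o\in M$: either $m\preceq n$ or $n\preceq m$ (in particular $\preceq$ is total and reflexive), and $m\preceq n\preceq o$ implies $m\preceq o$. An additive preorder on $M$ is a preorder $\preceq$ such that $m\preceq m'$ implies $m+n\preceq m'+n$ for all $n\in M$. An additive order is an additive preorder which is an order (i.e. is antisymmetric). The trivial preorder, for which all elements are equivalent, is an additive preorder. Denote by $ZR(M)$ the set of all additive preorders on $M$; for $w\in ZR(M)$ the corresponding relation is written $\preceq_w$. Topology on $ZR(M)$: a rational polyhedral cone $\sigma\subset N_{\mathbf{R}}$ is a cone positively generated by finitely many vectors of $N$; its convex dual is $\check\sigma=\{u\in\mathbf{R}^r : \langle u,v\rangle\geq 0\ \ \forall v\in\sigma\}$. Set $\mathcal U_\sigma=\{w\in ZR(M) : 0\preceq_w m \text{ for all } m\in\check\sigma\cap M\}$. The sets $\mathcal U_\sigma$, for $\sigma$ a rational polyhedral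 cone in $N_{\mathbf{R}}$, are a basis of open sets for the topology of $ZR(M)$. Equivalently, this is the topology having as a pre-basis of open sets the sets $\mathcal U_{a,b}=\{w\in ZR(M) : a\preceq_w b\}$ for $a,b\in M$. Quasi-compact means that every open cover has a finite subcover (no Hausdorff condition). *)

(* Defs.v *)
From HB Require Import structures.
From mathcomp Require Import all_boot all_order all_algebra.
From mathcomp Require Import all_classical all_reals all_analysis.

Set Implicit Arguments.
Unset Strict Implicit.
Unset Printing Implicit Defensive.

Import Order.TTheory GRing.Theory Num.Theory.

Local Open Scope classical_set_scope.
Local Open Scope ring_scope.

Record additive_preorder (r : nat) := AdditivePreorder {
  preceq : rel 'rV[int]_r;
  preceq_total : total preceq;
  preceq_trans : transitive preceq;
  preceq_add : forall m m' n : 'rV[int]_r,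
    preceq m m' -> preceq (m + n) (m' + n)
}.

Definition trivial_preorder (r : nat) : additive_preorder r :=
  @AdditivePreorder r (fun _ _ => true)
    (fun _ _ => erefl) (fun _ _ _ _ _ => erefl) (fun _ _ _ _ => erefl).

(* The carrier does not depend on R; the topology below is defined through
   cones in the real vector space N_R, so R is kept as a parameter. *)
Definition ZR (R : realType) (r : nat) : Type := additive_preorder r.

Section Topology.
Variables (R : realType) (r : nat).

(* R^o is the line R as a vector space: this is the dual space of R^r. *)
Definition N_R := 'Hom('rV[R]_r, R^o).

(* The canonical image of Z^r in R^r. *)
Definition realvec (m : 'rV[int]_r) : 'rV[R]_r := map_mx intr m.

(* Hom(Z^r, Z), as the lattice of the linear forms on R^r that are
   integer-valued on Z^r. *)
Definition dual_lattice : set N_R :=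
  [set v | forall m : 'rV[int]_r, v (realvec m) \is a Num.int].

Definition cone_generated (k : nat) (g : 'I_k -> N_R) : set N_R :=
  [set v | exists c : 'I_k -> R,
    (forall i, 0 <= c i) /\ v = \sum_(i < k) c i *: g i].

Definition rational_polyhedral_cone : set (set N_R) :=
  [set sigma | exists (k : nat) (g : 'I_k -> N_R),
    (forall i, dual_lattice (g i)) /\ sigma = cone_generated g].

Definition convex_dual (sigma : set N_R) : set 'rV[R]_r :=
  [set u | forall v, sigma v -> 0 <= (v u : R)].

Definition U_cone (sigma : set N_R) : set (ZR R r) :=
  [set w | forall m : 'rV[int]_r,
    convex_dual sigma (realvec m) -> preceq w 0 m].

HB.instance Definition _ := gen_eqMixin (ZR R r).
HB.instance Definition _ := gen_choiceMixin (ZR R r).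
HB.instance Definition _ := isPointed.Build (ZR R r) (trivial_preorder r).

(* The topology generated by the sets U_cone sigma, sigma rational polyhedral.
   They form a basis of it, and not only a subbasis, since
   U_cone sigma `&` U_cone tau = U_cone (sigma `&` tau). *)
HB.instance Definition _ :=
  @isSubBaseTopological.Build (ZR R r) (set N_R)
    rational_polyhedral_cone U_cone.

Definition additive_orders : set (ZR R r) :=
  [set w | antisymmetric (preceq w)].

End Topology.

Definition homeomorphic (X Y : topologicalType) : Prop :=
  exists (f : X -> Y) (g : Y -> X),
    [/\ cancel f g, cancel g f, continuous f & continuous g].

(* Main.v *)
From HB Require Import structures.
Require Import Defs.
From mathcomp Require Import all_boot all_order all_algebra.
From mathcomp Require Import all_classical all_reals all_analysis.
From mathcomp Require Import lra zify.

(** An additive preorder [w] on [Z^r] is determined by its positive cone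
    [{m | 0 <=_w m}], and the positive cones are exactly the additively closed
    [P] such that [m] or [- m] lies in [P] for every [m] ([cone_preorder]).

    The topology is that of pointwise convergence of positive cones, where only
    the conditions [0 <=_w m] are declared open ([ZR_nbhsP]). These conditions
    are open because, for [m <> 0], the ray spanned by [m] is the convex dual of
    a half-space, which is a rational polyhedral cone ([U_cone_ray]).
    Conversely, the lattice points of the dual of a rational polyhedral cone
    form a finitely generated monoid ([gordan], from Dickson's lemma
    [dickson]), so each [U_sigma] is a finite intersection of such conditions
    ([U_cone_finite]).

    Quasi-compactness: an ultrafilter [F] on the space of preorders converges to
    the preorder whose positive cone is the set of the [m] such that
    [0 <=_w m] holds for [F]-almost every [w]. A preorder that is not an order
    satisfies [0 <=_w m] and [0 <=_w - m] for some [m <> 0], an open condition,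
    so the orders form a closed set.

    On orders, the condition [0 <=_w m] with [m <> 0] is the negation of
    [0 <=_w - m]; hence the countably many sets [{w | 0 <=_w m}] are clopen,
    and they separate points. What remains for Brouwer's characterization
    of the Cantor set is that no order is isolated ([order_not_isolated]).
    A finite set [F] of strictly positive elements of an order generates a
    semigroup that avoids 0, so by Fourier-Motzkin elimination some integer
    linear form [l] is positive on [F] ([positive_form]). The order that first
    compares the values of [l] and breaks ties with the opposite of [w] makes
    [F] positive. As [r >= 2], the kernel of [l] is nontrivial; the new order
    and [w] are opposite there, hence distinct.

    Brouwer's characterization is applied to the pseudometric of the sequence
    space [bool^nat], pulled back along the map which sends a point to the
    sequence of its memberships in a countable separating family of clopen sets
    ([homeomorphic_cantor_space]). *)

Set Implicit Arguments.
Unset Strict Implicit.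
Unset Printing Implicit Defensive.

Import Order.TTheory GRing.Theory Num.Theory.

Local Open Scope classical_set_scope.
Local Open Scope ring_scope.

(** * Finite generation of lattice cones *)

(** Dickson's lemma. The functions [c i], for [i] in [s], send [T] to [nat ^ s];
    each subset [S] of [T] has a finite part such that every element of [S]
    dominates a member of that part, for the order pulled back from
    [nat ^ s]. *)
Lemma dickson (T I : eqType) (c : I -> T -> nat) (s : seq I) (S : set T) :
  exists2 B : seq T, {in B, forall b, S b} &
    forall x, S x -> exists2 b, b \in B & {in s, forall i, (c i b <= c i x)%N}.
Proof.
elim: s S => [|i s IH] S.
  have [[x Sx]|S0] := pselect (S !=set0).
    by exists [:: x] => [b|y _]; [rewrite inE => /eqP -> | exists x; rewrite ?inE].
  by exists [::] => // x Sx; case: S0; exists x.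
have [B0 SB0 domB0] := IH S.
(* An element whose coordinate [i] is at least [bound] dominates a member of
   [B0]; there are finitely many slices below [bound]. *)
pose slice n := cid2 (IH (S `&` [set x | c i x = n])).
pose bound := (\max_(b <- B0) c i b)%N.
exists (B0 ++ flatten [seq projT1 (slice n) | n <- iota 0 bound]).
  move=> b; rewrite mem_cat => /orP[/SB0//|/flattenP[_ /mapP[n _ ->]]].
  by case: (slice n) => B /= SB _ /SB [].
move=> x Sx; have [lt_x|le_x] := ltnP (c i x) bound.
  have [b Bb leb] : exists2 b, b \in projT1 (slice (c i x)) &
      {in s, forall j, (c j b <= c j x)%N}.
    by case: (slice _) => B /= _; apply.
  have cb : c i b = c i x.
    by move: Bb; case: (slice _) => B /= SB _ /SB [].
  exists b.
    rewrite mem_cat; apply/orP; right; apply/flattenP.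
    by exists (projT1 (slice (c i x))) => //; apply: map_f; rewrite mem_iota.
  by move=> j; rewrite inE => /predU1P[->|/leb//]; rewrite cb.
have [b B0b leb] := domB0 x Sx; exists b; first by rewrite mem_cat B0b.
move=> j; rewrite inE => /predU1P[->|/leb//].
by apply: leq_trans le_x; exact: leq_bigmax_seq.
Qed.

Lemma abszB_posneg (x y : int) :
  ((if (0 <= y)%R then `|y| else 0) <= (if (0 <= x)%R then `|x| else 0))%N ->
  ((if (0 <= y)%R then 0 else `|y|) <= (if (0 <= x)%R then 0 else `|x|))%N ->
  (`|(x - y)%R| + `|y| = `|x|)%N.
Proof. by case: ifP => hx; case: ifP => hy; lia. Qed.

(** Gordan's lemma: the lattice points at which finitely many integer forms are
    nonnegative are the sums of elements of a finite set [B]. Being such a sum is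
    expressed by induction: it is membership in every additive submonoid that
    contains [B]. *)
Lemma gordan (r : nat) (I : finType) (l : I -> 'rV[int]_r -> int) :
  (forall i, {morph l i : x y / x - y}) ->
  exists2 B : seq 'rV[int]_r, {in B, forall b i, 0 <= l i b} &
    forall P : set 'rV[int]_r, P 0 -> (forall a b, P a -> P b -> P (a + b)) ->
      {in B, forall b, P b} -> forall m, (forall i, 0 <= l i m) -> P m.
Proof.
move=> lB.
(* The values of the forms together with the positive and negative parts of the
   coordinates: if [b] is below [m] for [c], then [m - b] is still in the cone
   and its l1-norm is that of [m] minus that of [b]. *)
pose c (j : I + ('I_r + 'I_r)) (m : 'rV[int]_r) : nat :=
  match j with
  | inl i => `|l i m|%N
  | inr (inl j) => if (0 <= m ord0 j)%R then `|m ord0 j|%N else 0%N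
  | inr (inr j) => if (0 <= m ord0 j)%R then 0%N else `|m ord0 j|%N
  end.
pose S := [set m : 'rV[int]_r | m <> 0 /\ forall i, 0 <= l i m].
have [B SB domB] : exists2 B : seq 'rV[int]_r, {in B, forall b, S b} &
    forall m, S m -> exists2 b : 'rV[int]_r, b \in B &
      forall j, (c j b <= c j m)%N.
  have [B SB domB] := dickson c (enum {: I + ('I_r + 'I_r)}) S.
  exists B => // m /domB[b Bb leb]; exists b => // j.
  by apply: leb; rewrite mem_enum.
exists B => [b /SB []//|P P0 PD PB m lm].
pose N (m : 'rV[int]_r) : nat := (\sum_j `|m ord0 j|)%N.
have [n] := ubnP (N m); elim: n m lm => // n IH m lm ltN.
have [->//|/eqP m0] := eqVneq m 0.
have [b Bb cM] := domB m (conj m0 lm).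
have [b0 lb] := SB _ Bb.
rewrite -[m](subrK b); apply: PD; last exact: PB.
have Ecoord j : (`|(m - b)%R ord0 j| + `|b ord0 j| = `|m ord0 j|)%N.
  have := cM (inr (inr j)); have := cM (inr (inl j)).
  by rewrite /= !mxE; exact: abszB_posneg.
apply: IH => [i|].
  by rewrite lB; have := cM (inl i); have := lm i; have := lb i; rewrite /=; lia.
have NE : (N (m - b)%R + N b = N m)%N.
  by rewrite /N -big_split /=; apply: eq_bigr => j _; exact: Ecoord.
rewrite -ltnS; apply: leq_trans ltN; rewrite ltnS -NE -addn1 leq_add2l.
rewrite lt0n; apply: contra_notN b0 => /eqP Nb; apply/rowP => j.
have : (`|b ord0 j| <= N b)%N by rewrite /N (bigD1 j)//= leq_addr.
by rewrite mxE Nb leqn0 absz_eq0 => /eqP.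
Qed.

(** * A linear form positive on a finite set *)

Lemma dense_below (B : seq rat) (a : rat) : {in B, forall b, a < b} ->
  exists2 t, a < t & {in B, forall b, t < b}.
Proof.
elim: B => [|b B IH] aB; first by exists (a + 1) => //; lra.
have [|t at_ tB] := IH; first by move=> x xB; apply: aB; rewrite inE xB orbT.
have ab : a < b by apply: aB; rewrite mem_head.
exists (Num.min t ((a + b) / 2)); first by rewrite lt_min at_; lra.
move=> x; rewrite inE => /predU1P[->|/tB tx]; rewrite gt_min ?tx//.
by apply/orP; right; lra.
Qed.

Lemma exists_between (A B : seq rat) : {in A & B, forall a b, a < b} ->
  exists2 t, {in A, forall a, a < t} & {in B, forall b, t < b}.
Proof.
elim: A => [|a A IH] AB.
  suff [t tB] : exists t, {in B, forall b, t < b} by exists t.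
  elim: B {AB} => [|b B [t tB]]; first by exists 0.
  exists (Num.min t (b - 1)) => x; rewrite inE => /predU1P[->|/tB tx].
    by rewrite gt_min; apply/orP; right; lra.
  by rewrite gt_min tx.
have [x y xA yB|t tA tB] := IH; first by apply: AB => //; rewrite inE xA orbT.
have [b bB|u au uB] := @dense_below B (Num.max a t).
  by rewrite gt_max tB// AB ?mem_head.
move: au; rewrite gt_max => /andP[au tu].
by exists u => // x; rewrite inE => /predU1P[->//|/tA /lt_trans]; apply.
Qed.

Lemma mulrn_absz_ge0 (x y : int) : 0 <= y -> x *+ `|y| = x * y.
Proof. by case: y => // n _; rewrite -mulr_natr natz. Qed.

Lemma mulrn_absz_lt0 (x y : int) : y < 0 -> x *+ `|y| = x * - y.
Proof. by move=> y0; rewrite -abszN mulrn_absz_ge0 ?oppr_ge0 ?ltW. Qed.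

(** Fourier-Motzkin elimination. If the semigroup [P] contains no element at
    which all the forms [c i], [i] in [s], vanish (in particular, not 0), then
    every finite part of [P] lies in the open half-space of a linear form. *)
Lemma positive_form (V : zmodType) (I : eqType) (c : I -> {additive V -> int})
    (s : seq I) (P : set V) (F : seq V) :
  (forall a b, P a -> P b -> P (a + b)) ->
  (forall p, P p -> exists2 i, i \in s & c i p != 0) ->
  {in F, forall f, P f} ->
  exists l : {additive V -> int}, {in F, forall f, 0 < l f}.
Proof.
elim: s P F => [|i s IH] P F PD Pc FP.
  by exists (\0 : {additive V -> int}) => f /FP /Pc [].
have PM a n : P a -> P (a *+ n.+1).
  by move=> Pa; elim: n => // n IHn; rewrite mulrS; exact: PD.
(* Eliminating [c i]: [F'] consists of the elements of [F] at which [c i]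
   vanishes, and of a combination at which it vanishes for each pair of
   elements of [F] where it has opposite signs. *)
pose Fpos := [seq f <- F | 0 < c i f]; pose Fneg := [seq f <- F | c i f < 0].
pose F' := [seq f <- F | c i f == 0] ++
  [seq a *+ `|c i b| + b *+ `|c i a| | a <- Fpos, b <- Fneg].
have [||f|mu muF'] := IH (P `&` [set p | c i p = 0]) F'.
- by move=> a b [Pa ca] [Pb cb]; split; [exact: PD | rewrite /= raddfD/= ca cb].
- move=> p [/Pc [j + cj] cp]; rewrite inE => /predU1P[ji|js]; last by exists j.
  by move: cj; rewrite ji cp eqxx.
- rewrite mem_cat => /orP[|/allpairsP[[a b] /= [+ + ->]]].
    by rewrite mem_filter => /andP[/eqP ? /FP].
  rewrite !mem_filter => /andP[ca /FP Pa] /andP[cb /FP Pb]; split.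
    apply: PD; first by case: (`|c i b|)%N (absz_gt0 (c i b)) => [|n _]; [lia|exact: PM].
    by case: (`|c i a|)%N (absz_gt0 (c i a)) => [|n _]; [lia|exact: PM].
  rewrite /= raddfD /= !raddfMn /=.
  by rewrite (mulrn_absz_ge0 _ (ltW ca)) (mulrn_absz_lt0 _ cb) mulrN addrC mulrC subrr.
(* For [c i f <> 0], the form [mu + t * c i] is positive at [f] if and only
   if [t] is on the right side of [tau f]: above it for [f] in [Fpos], below it
   for [f] in [Fneg]. *)
pose tau f : rat := - (mu f)%:~R / (c i f)%:~R.
have [_ _ /mapP[a aF ->] /mapP[b bF ->]|t tpos tneg] :=
    @exists_between (map tau Fpos) (map tau Fneg).
  have : 0 < mu (a *+ `|c i b| + b *+ `|c i a|).
    apply: muF'; rewrite mem_cat; apply/orP; right.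
    by apply/allpairsP; exists (a, b).
  move: aF bF; rewrite !mem_filter => /andP[ca _] /andP[cb _].
  rewrite raddfD /= !raddfMn /=.
  rewrite (mulrn_absz_ge0 _ (ltW ca)) (mulrn_absz_lt0 _ cb) => mu0.
  have : 0 < (mu a)%:~R * - (c i b)%:~R + (mu b)%:~R * (c i a)%:~R :> rat.
    by rewrite -mulrNz -!intrM -intrD ltr0z.
  have {}ca : 0 < (c i a)%:~R :> rat by rewrite ltr0z.
  have {}cb : 0 < - (c i b)%:~R :> rat by rewrite -mulrNz ltr0z; lia.
  rewrite /tau => h.
  have -> : - (mu b)%:~R / (c i b)%:~R = (mu b)%:~R / - (c i b)%:~R :> rat.
    by rewrite invrN mulrN mulNr.
  by rewrite ltr_pdivrMr// mulrAC ltr_pdivlMr//; lra.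
(* The form [mu + t * c i], scaled by the denominator of [t]. *)
exists ((denq t \*o mu) \+ (numq t \*o c i)) => f fF /=.
have tE : t = (numq t)%:~R / (denq t)%:~R by rewrite divq_num_den.
have dt : 0 < (denq t)%:~R :> rat by rewrite ltr0z denq_gt0.
rewrite -(ltr0z rat) intrD !intrM.
have -> : (numq t)%:~R = t * (denq t)%:~R :> rat by rewrite {2}tE divfK ?gt_eqF.
rewrite mulrAC mulrC -mulrDl pmulr_lgt0//.
have [cf|cf|cf] := ltgtP (c i f) 0; last first.
- rewrite cf mulr0 addr0 ltr0z; apply: muF'.
  by rewrite mem_cat mem_filter cf eqxx fF.
- have := tpos (tau f); rewrite map_f ?mem_filter ?cf// /tau => /(_ isT).
  by rewrite ltr_pdivrMr ?ltr0z//; lra.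
have := tneg (tau f); rewrite map_f ?mem_filter ?cf// /tau => /(_ isT).
by rewrite ltr_ndivlMr ?ltrz0//; lra.
Qed.

(** * Additive preorders and their positive cones *)

Section Preorders.
Variable r : nat.
Implicit Types (w : additive_preorder r) (m n : 'rV[int]_r).

Lemma preceqE w m n : preceq w m n = preceq w 0 (n - m).
Proof.
by apply/idP/idP => [/(preceq_add (-m))|/(preceq_add m)]; rewrite ?subrr ?subrK ?add0r.
Qed.

Lemma preceq_refl w m : preceq w m m.
Proof. by have := preceq_total w m m; rewrite orbb. Qed.

Lemma preceq0D w m n : preceq w 0 m -> preceq w 0 n -> preceq w 0 (m + n).
Proof.
by move=> m0 /(preceq_add m); rewrite add0r addrC; exact: preceq_trans.
Qed.

Lemma preceq0_total w m : preceq w 0 m || preceq w 0 (- m).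
Proof. by rewrite -[- m]sub0r -preceqE; exact: preceq_total. Qed.

Lemma preceq0_mulrn w m (n : nat) : preceq w 0 m -> preceq w 0 (m *+ n).
Proof.
move=> m0; elim: n => [|n IH]; first exact: preceq_refl.
by rewrite mulrS; exact: preceq0D.
Qed.

(** Positive cones are saturated. *)
Lemma preceq0_mulrnI w m (n : nat) : preceq w 0 (m *+ n.+1) -> preceq w 0 m.
Proof.
move=> mn; have /orP[//|Nm] := preceq0_total w m.
rewrite -[m](addrK (m *+ n)) -mulrS; apply: preceq0D => //.
by rewrite -mulNrn; exact: preceq0_mulrn.
Qed.

Lemma additive_preorder_ext w1 w2 : preceq w1 0 =1 preceq w2 0 -> w1 = w2.
Proof.
move=> w12; have : preceq w1 = preceq w2.
  by apply/funext => m; apply/funext => n; rewrite preceqE w12 -preceqE.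
case: w1 w2 {w12} => [p1 tot1 tr1 add1] [p2 tot2 tr2 add2] /= p12.
move: tot1 tr1 add1; rewrite p12 => tot1 tr1 add1.
by congr AdditivePreorder; exact: Prop_irrelevance.
Qed.

Section ConePreorder.
Variables (P : pred 'rV[int]_r) (P_total : forall m, P m || P (- m)).
Hypothesis PD : forall m n, P m -> P n -> P (m + n).

Let cone_total : total (fun m n => P (n - m)).
Proof. by move=> m n; rewrite -[m - n]opprB. Qed.

Let cone_trans : transitive (fun m n => P (n - m)).
Proof. by move=> n m o mn no; rewrite -(subrKA n) addrC PD. Qed.

Let cone_add m n o : P (n - m) -> P ((n + o) - (m + o)).
Proof. by rewrite opprD addrACA subrr addr0. Qed.

(** The additive preorder with positive cone [P]. *)
Definition cone_preorder : additive_preorder r :=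
  AdditivePreorder cone_total cone_trans cone_add.

Lemma cone_preorderE m : preceq cone_preorder 0 m = P m.
Proof. by rewrite /= subr0. Qed.

End ConePreorder.

Section Refinement.
Variables (l : {additive 'rV[int]_r -> int}) (w : additive_preorder r).

Let P m := (0 < l m) || (l m == 0) && preceq w 0 m.

Let P_total m : P m || P (- m).
Proof.
rewrite /P raddfN/= oppr_gt0 oppr_eq0.
by have := preceq0_total w m; case: (ltgtP (l m) 0); rewrite ?orbT.
Qed.

Let PD m n : P m -> P n -> P (m + n).
Proof.
rewrite /P raddfD/=.
move=> /orP[lm|/andP[/eqP lm wm]] /orP[ln|/andP[/eqP ln wn]].
- by rewrite addr_gt0.
- by rewrite ln addr0 lm.
- by rewrite lm add0r ln.
- by rewrite lm ln addr0 eqxx preceq0D ?orbT.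
Qed.

(** The lexicographic preorder: first compare the values of [l], then break ties
    with [w]. *)
Definition refine := cone_preorder P_total PD.

Lemma refineE m :
  preceq refine 0 m = (0 < l m) || (l m == 0) && preceq w 0 m.
Proof. exact: cone_preorderE. Qed.

End Refinement.

Section Opposite.
Variable w : additive_preorder r.

Let opp_total : total (fun m n => preceq w n m).
Proof. by move=> m n; exact: preceq_total. Qed.

Let opp_trans : transitive (fun m n => preceq w n m).
Proof. by move=> n m o mn no; exact: preceq_trans no mn. Qed.

Let opp_add m n o : preceq w n m -> preceq w (n + o) (m + o).
Proof. exact: preceq_add. Qed.

(** The preorder [w] reversed. *)
Definition opp_preorder : additive_preorder r :=
  AdditivePreorder opp_total opp_trans opp_add.

Lemma opp_preorderE m : preceq opp_preorder 0 m = preceq w 0 (- m).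
Proof. by rewrite /= preceqE sub0r. Qed.

End Opposite.

Lemma antisymmetricP w : antisymmetric (preceq w) <->
  (forall m, preceq w 0 m -> preceq w 0 (- m) -> m = 0).
Proof.
split=> [anti m m0 Nm0|anti m n /andP[mn nm]].
  by apply/esym/anti; rewrite m0 preceqE sub0r.
by apply/eqP; rewrite -subr_eq0; apply/eqP/anti; rewrite ?opprB -preceqE.
Qed.

Lemma refine_anti l w : antisymmetric (preceq w) ->
  antisymmetric (preceq (refine l w)).
Proof.
move=> /antisymmetricP anti; apply/antisymmetricP => m; rewrite !refineE raddfN/=.
by rewrite oppr_gt0 oppr_eq0; case: ltgtP => // _; exact: anti.
Qed.

Lemma opp_anti w : antisymmetric (preceq w) -> antisymmetric (preceq (opp_preorder w)).
Proof. by move=> anti m n; rewrite andbC; exact: anti. Qed.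

(** The coordinate forms of [Z^r]. *)
Definition coordinate (i : 'I_r) (m : 'rV[int]_r) : int := m ord0 i.

Let coordinateB i : zmod_morphism (coordinate i).
Proof. by move=> m n; rewrite /coordinate !mxE. Qed.

HB.instance Definition _ i :=
  GRing.isZmodMorphism.Build _ _ (coordinate i) (coordinateB i).

(** The lexicographic order. *)
Lemma exists_additive_order : exists w, antisymmetric (preceq w).
Proof.
pose lex s := foldr (fun i w => refine (coordinate i) w) (trivial_preorder r) s.
suff lex0 s m : preceq (lex s) 0 m -> preceq (lex s) 0 (- m) ->
    {in s, forall i, m ord0 i = 0}.
  exists (lex (enum 'I_r)); apply/antisymmetricP => m m0 Nm0; apply/rowP => i.
  by rewrite mxE; apply: (lex0 _ _ m0 Nm0); rewrite mem_enum.
elim: s => // i s IH; have -> : lex (i :: s) = refine (coordinate i) (lex s) by [].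
rewrite !refineE raddfN /= /coordinate oppr_gt0 oppr_eq0.
case: ltgtP => //= mi ms Nms j; rewrite inE => /predU1P[->//|js].
exact: IH.
Qed.

(** In rank at least 2, a form [l] vanishes at [e_0] or else, if [l(e_0) <> 0], at
    the nonzero vector [l(e_1) e_0 - l(e_0) e_1]. *)
Lemma kernel_nontrivial (l : {additive 'rV[int]_r -> int}) : (2 <= r)%N ->
  exists2 k, k <> 0 & l k = 0.
Proof.
move=> r2; pose i0 : 'I_r := Ordinal (ltnW r2); pose i1 : 'I_r := Ordinal r2.
pose e i : 'rV[int]_r := delta_mx ord0 i.
have e0 i : e i <> 0.
  by move=> /rowP/(_ i); rewrite !mxE !eqxx.
have [l0|l0] := eqVneq (l (e i0)) 0; first by exists (e i0).
exists (e i0 *~ l (e i1) - e i1 *~ l (e i0)).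
  move=> /(congr1 (coordinate i1)) /eqP.
  rewrite raddfB/= !raddfMz/= raddf0 /coordinate !mxE !eqxx/=.
  by rewrite mul0rz add0r mulNrz mulrzz mul1r oppr_eq0 (negPf l0).
by rewrite raddfB/= !raddfMz/= !mulrzz mulNr mulrC subrr.
Qed.

(** Nonzero positive elements of an order are strictly positive, and the
    strictly positive elements form a semigroup that avoids 0. *)
Lemma preorder_positive_form w (F : seq 'rV[int]_r) :
  {in F, forall f, f <> 0} ->
  antisymmetric (preceq w) -> {in F, forall f, preceq w 0 f} ->
  exists l : {additive 'rV[int]_r -> int}, {in F, forall f, 0 < l f}.
Proof.
move=> F0 /antisymmetricP anti Fw.
apply: (@positive_form _ _ coordinate (enum 'I_r)
  [set m | preceq w 0 m /\ ~~ preceq w 0 (- m)]).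
- move=> a b [a0 Na] [b0 Nb]; split; first exact: preceq0D.
  apply: contra Na => Nab; have -> : - a = b - (a + b).
    by rewrite opprD addrCA subrr addr0.
  exact: preceq0D.
- move=> m [m0 Nm].
  apply: contrapT => nocoord; move: Nm.
  suff -> : m = 0 by rewrite oppr0 preceq_refl.
  apply/rowP => i; rewrite mxE; apply: contrapT => /eqP mi.
  by apply: nocoord; exists i; rewrite ?mem_enum.
- move=> f fF; split; first exact: Fw.
  by apply/negP => /(anti f (Fw f fF))/F0; apply.
Qed.

End Preorders.

(** No additive order is isolated: finitely many of its positive elements do not
    determine it. *)
Lemma order_not_isolated r (w : additive_preorder r) (F : seq 'rV[int]_r) :
  (2 <= r)%N -> antisymmetric (preceq w) -> {in F, forall f, preceq w 0 f} ->
  exists w', [/\ antisymmetric (preceq w'), {in F, forall f, preceq w' 0 f}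
    & w' <> w].
Proof.
move=> r2 anti Fw.
have [||l lF] := @preorder_positive_form r w [seq f <- F | f != 0] _ anti.
- by move=> f; rewrite mem_filter => /andP[/eqP].
- by move=> f; rewrite mem_filter => /andP[_ /Fw].
have Fref w' : {in F, forall f, preceq (refine l w') 0 f}.
  move=> f fF; have [->|f0] := eqVneq f 0; first exact: preceq_refl.
  by rewrite refineE lF// mem_filter f0.
have [k k0 lk] := kernel_nontrivial l r2.
exists (refine l (opp_preorder w)); split => [||w'w].
- exact/refine_anti/opp_anti.
- exact: Fref.
have wk : preceq w 0 k = preceq w 0 (- k).
  by rewrite -{1}w'w refineE lk eqxx ltxx orFb andTb opp_preorderE.
have := preceq0_total w k; rewrite -wk orbb => kk; apply: k0.
by move/antisymmetricP: anti; apply; rewrite -?wk.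
Qed.

(** * The topology of the space of additive preorders *)

Section ZRTopology.
Variables (R : realType) (r : nat).
Implicit Types (w : ZR R r) (m n : 'rV[int]_r).

(** The preorders in which [m] is nonnegative: the sets [U_{0,m}] of the usual
    subbase. *)
Definition nonneg_at m : set (ZR R r) := [set w | preceq w 0 m].

Lemma realvecB : {morph @realvec R r : m n / m - n}.
Proof. by move=> m n; apply/rowP => i; rewrite !mxE rmorphB. Qed.

Lemma U_cone_finite (sigma : set (N_R R r)) :
  rational_polyhedral_cone sigma ->
  exists B : seq 'rV[int]_r,
    U_cone sigma = [set w : ZR R r | {in B, forall b, preceq w 0 b}].
Proof.
move=> [k [g [g_int ->]]].
pose l i m := Num.floor (g i (realvec R m) : R).
have lE i m : (l i m)%:~R = g i (realvec R m).
  by apply/eqP; rewrite -intrEfloor; exact: g_int.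
have dualE m : convex_dual (cone_generated g) (realvec R m) <->
    forall i, 0 <= l i m.
  split=> [cm i|lm v [c [c0 ->]]].
    rewrite -(ler0z R) lE; apply: cm.
    exists (fun j => (j == i)%:R); split=> [j|]; first by rewrite ler0n.
    rewrite (bigD1 i)//= eqxx scale1r big1 ?addr0// => j /negPf->.
    by rewrite scale0r.
  rewrite sum_lfunE sumr_ge0 // => i _; rewrite scale_lfunE.
  by rewrite mulr_ge0// -lE ler0z.
have lB i : {morph l i : m n / m - n}.
  move=> m n; apply/eqP; rewrite -(eqr_int R) rmorphB/= !lE.
  by rewrite realvecB linearB.
have [B lB0 genB] := gordan lB.
exists B; apply/seteqP; split => w /=.
  by move=> Uw b bB; apply/Uw/dualE => i; exact: lB0.
move=> Bw m /dualE lm.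
apply: (genB [set m | preceq w 0 m]) => //=; first exact: preceq_refl.
by move=> a b; exact: preceq0D.
Qed.

(** The standard scalar product of [Z^r]. *)
Definition int_dot (n m : 'rV[int]_r) : int := \sum_j n ord0 j * m ord0 j.

(** Its extension to [R^r] in the second argument. The values are in [R^o], the
    line [R] as a vector space, for this to be a linear form. *)
Definition real_dot n (u : 'rV[R]_r) : R^o := \sum_j (n ord0 j)%:~R * u ord0 j.

Let real_dot_linear n : linear (real_dot n).
Proof.
move=> a u v; rewrite /real_dot scaler_sumr -big_split/=; apply: eq_bigr => j _.
by rewrite !mxE mulrDr; congr (_ + _); rewrite mulrCA.
Qed.

HB.instance Definition _ n :=
  GRing.isLinear.Build R 'rV[R]_r R^o _ (real_dot n) (real_dot_linear n).

(** The element of the lattice [N] with coordinates [n]. *)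
Definition int_form n : N_R R r := linfun (real_dot n).

Lemma int_formE n m : int_form n (realvec R m) = (int_dot n m)%:~R :> R.
Proof.
rewrite lfunE /= /real_dot /int_dot rmorph_sum/=; apply: eq_bigr => j _.
by rewrite mxE intrM.
Qed.

Lemma int_formP n : dual_lattice (int_form n).
Proof. by move=> m; rewrite int_formE intr_int. Qed.

(** The cone is the half-space [{v | 0 <= v(m)}], generated by [m] itself and by
    the forms [d i] and [- d i] that vanish at [m], where
    [d i = q e_i - m_i m] and [q] is the square of the norm of [m]. A lattice
    point [u] in the dual satisfies [q u = <m, u> m]. *)
Lemma U_cone_ray m : m <> 0 -> exists2 sigma : set (N_R R r),
  rational_polyhedral_cone sigma & U_cone sigma = nonneg_at m.
Proof.
move=> m0; pose q := int_dot m m.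
have q0 : 0 < q.
  rewrite lt_def sumr_ge0 ?andbT => [|j _]; last by rewrite -expr2 sqr_ge0.
  apply: contra_not_neq m0 => /eqP; rewrite psumr_eq0 => [/allP q0|j _].
    apply/rowP => j; rewrite mxE; apply/eqP.
    by have := q0 j (mem_index_enum _); rewrite mulf_eq0 orbb.
  by rewrite -expr2 sqr_ge0.
pose d i : 'rV[int]_r := \row_j (q * (j == i)%:R - m ord0 i * m ord0 j).
have dE i u : int_dot (d i) u = q * u ord0 i - m ord0 i * int_dot m u.
  rewrite /int_dot (eq_bigr (fun j =>
    q * ((j == i)%:R * u ord0 j) - m ord0 i * (m ord0 j * u ord0 j))).
    rewrite sumrB -!mulr_sumr (bigD1 i)//= eqxx mul1r big1 ?addr0// => j /negPf->.
    by rewrite mul0r.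
  by move=> j _; rewrite mxE mulrBl !mulrA.
have NdE i u : int_dot (- d i) u = - int_dot (d i) u.
  by rewrite /int_dot -sumrN; apply: eq_bigr => j _; rewrite mxE mulNr.
pose s := m :: [seq d i | i <- enum 'I_r] ++ [seq - d i | i <- enum 'I_r].
pose g (k : 'I_(size s)) := int_form (nth 0 s k).
exists (cone_generated g).
  by exists (size s), g; split=> // k; exact: int_formP.
apply/seteqP; split=> w /= wm.
  apply: wm => v [c [c0 ->]]; rewrite sum_lfunE sumr_ge0// => k _.
  rewrite scale_lfunE mulr_ge0// int_formE ler0z.
  have : nth 0 s k \in s by exact: mem_nth.
  rewrite inE => /predU1P[->|]; first exact: ltW.
  rewrite mem_cat => /orP[] /mapP[i _ ->]; rewrite ?NdE dE mulrC subrr ?oppr0//.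
move=> u dual_u.
have su n : n \in s -> 0 <= int_dot n u.
  move=> ns; rewrite -(ler0z R) -int_formE; apply: dual_u.
  have ltn : (index n s < size s)%N by rewrite index_mem.
  exists (fun k => (k == Ordinal ltn)%:R); split=> [k|]; first by rewrite ler0n.
  rewrite (bigD1 (Ordinal ltn))//= eqxx scale1r big1 ?addr0.
    by rewrite /g/= nth_index.
  by move=> k /negPf->; rewrite scale0r.
have mu : 0 <= int_dot m u by apply: su; exact: mem_head.
have uq : u *+ `|q| = m *+ `|int_dot m u|.
  apply/rowP => i; rewrite !mulmxnE !mulrn_absz_ge0 ?(ltW q0)//.
  have : 0 <= int_dot (d i) u.
    by apply: su; rewrite inE mem_cat map_f ?orbT// mem_enum.
  have : 0 <= int_dot (- d i) u.
    apply: su; rewrite inE mem_cat orbA orbC.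
    by rewrite (map_f (fun i => - d i)) ?mem_enum.
  rewrite NdE dE oppr_ge0 subr_le0 subr_ge0 => le1 le2.
  by apply: le_anti; rewrite mulrC le1 le2.
have := preceq0_mulrn `|int_dot m u| wm; rewrite -uq.
by case: (`|q|)%N (absz_gt0 q) => [|k _]; [rewrite gt_eqF|exact: preceq0_mulrnI].
Qed.

Lemma open_nonneg_at m : open (nonneg_at m).
Proof.
(* The cone of [U_cone_ray] does not work for [m = 0], where it would be 0. *)
have [->|/eqP m0] := eqVneq m 0.
  rewrite [X in open X](_ : _ = setT); first exact: openT.
  by apply/seteqP; split => // w _; exact: preceq_refl.
have [sigma sigma_cone <-] := U_cone_ray m0.
exists [set U_cone sigma]; last by rewrite bigcup_set1.
by move=> _ ->; exact: finI_from1.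
Qed.

(** Finite intersections of sets [nonneg_at b] in a filter. *)
Lemma filter_nonneg_at (F : set_system (ZR R r)) (B : seq 'rV[int]_r) :
  Filter F -> {in B, forall b, F (nonneg_at b)} ->
  F [set w | {in B, forall b, preceq w 0 b}].
Proof.
move=> FF; elim: B => [|b B IH] FB; first by apply: filterS filterT.
have := IH (fun c cB => FB c (mem_behead (s := b :: B) cB)).
apply: filterS2 (FB b (mem_head _ _)) => w wb wB c.
by rewrite inE => /predU1P[->|/wB].
Qed.

(** The sets of preorders in which finitely many given elements are nonnegative
    form a neighbourhood basis. *)
Lemma ZR_nbhsP w (A : set (ZR R r)) : nbhs w A <->
  exists2 B : seq 'rV[int]_r, {in B, forall b, preceq w 0 b} &
    [set w' : ZR R r | {in B, forall b, preceq w' 0 b}] `<=` A.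
Proof.
split=> [|[B]].
  rewrite nbhsE => -[U [[D' sD' <-] [V D'V Vw]] UA].
  have [J [sJ JA Jw]] : exists J : seq (set (N_R R r)),
      [/\ forall sigma, sigma \in J -> rational_polyhedral_cone sigma,
          forall w' : ZR R r, (forall sigma, sigma \in J -> U_cone sigma w') -> A w'
        & forall sigma, sigma \in J -> @U_cone R r sigma w].
    have [J sJ JV] := sD' _ D'V; exists (finmap.enum_fset J).
    split => [sigma /sJ/set_mem //|w' Jw'|].
      by apply: UA; exists V => //; rewrite /isBaseTopological.b/= -JV.
    by move: Vw; rewrite /isBaseTopological.b/= -JV.
  have /choice[B BE] : forall sigma, exists B : seq 'rV[int]_r, sigma \in J ->
      U_cone sigma = [set w : ZR R r | {in B, forall b, preceq w 0 b}].
    move=> sigma; have [sigmaJ|] := boolP (sigma \in J); last by exists [::].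
    by have [|B BE] := @U_cone_finite sigma; [exact: sJ|exists B].
  exists (flatten [seq B sigma | sigma <- J]) => [b /flattenP[_ /mapP[s Js ->]]|].
    by have := Jw _ Js; rewrite BE// => /[apply].
  move=> w' w'B; apply: JA => sigma Js; rewrite BE// => b bB.
  by apply: w'B; apply/flattenP; exists (B sigma) => //; exact: map_f.
move=> Bw BA; apply: (filterS BA); apply: filter_nonneg_at => b bB.
by apply: open_nbhs_nbhs; split; [exact: open_nonneg_at | exact: Bw].
Qed.

Lemma ZR_compact : compact [set: ZR R r].
Proof.
rewrite compact_ultra => F FU _.
(* The positive cone of the limit of [F]. *)
pose P m := `[< F (nonneg_at m) >].
have PT m : P m || P (- m).
  have [Fm|NFm] := in_ultra_setVsetC (nonneg_at m) FU.
    by apply/orP; left; apply/asboolP.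
  apply/orP; right; apply/asboolP; apply: filterS NFm => w /= /negP wm.
  by have := preceq0_total w m; rewrite (negPf wm).
have PD m n : P m -> P n -> P (m + n).
  move=> /asboolP Fm /asboolP Fn; apply/asboolP.
  by apply: filterS (filterI Fm Fn) => w [/= wm wn]; exact: preceq0D.
exists (cone_preorder PT PD); split => // A /ZR_nbhsP[B B0 BA].
apply: (filterS BA); apply: filter_nonneg_at => b bB.
by apply/asboolP; rewrite -[`[< _ >]]/(P b) -(cone_preorderE PT PD) B0.
Qed.

Lemma closed_additive_orders : closed (@additive_orders R r).
Proof.
rewrite -[X in closed X]setCK; apply: open_closedC.
suff -> : ~` @additive_orders R r =
    \bigcup_(m in [set m | m <> 0]) (nonneg_at m `&` nonneg_at (- m)).
  apply: bigcup_open => m _; apply: openI; exact: open_nonneg_at.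
apply/seteqP; split=> [w /= Nw|w [m m0 [/= wm wNm]] /antisymmetricP anti]; last first.
  exact/m0/anti.
apply: contrapT => noex; apply: Nw; apply/antisymmetricP => m m0 Nm0.
by apply: contrapT => mN0; apply: noex; exists m.
Qed.

End ZRTopology.

(** * A characterization of the Cantor space *)

Lemma compact_hausdorff_inverse_continuous (X Y : topologicalType)
    (f : X -> Y) (g : Y -> X) :
  compact [set: X] -> hausdorff_space Y -> continuous f ->
  cancel f g -> cancel g f -> continuous g.
Proof.
move=> cptX hY cf fK gK; apply/continuous_closedP => A clA.
have -> : g @^-1` A = f @` A.
  by apply/seteqP; split=> [y gy|_ [x Ax <-]]; [exists (g y)|rewrite /= fK].
apply: (compact_closed hY); apply: continuous_compact.
  exact: continuous_subspaceT.
exact: subclosed_compact clA cptX _.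
Qed.

Lemma injective_continuous_hausdorff (X Y : topologicalType) (f : X -> Y) :
  hausdorff_space Y -> injective f -> continuous f -> hausdorff_space X.
Proof.
move=> hY f_inj cf x y xy; apply/f_inj/hY => A B Ax By.
by have [z [Az Bz]] := xy _ _ (cf x _ Ax) (cf y _ By); exists (f z).
Qed.

(** Pulling back a pseudometric to a pointed type yields a pointed pseudometric
    space. *)
HB.instance Definition _ (R : realType) (S : pointedType)
    (T : pseudoMetricType R) (f : S -> T) := Pointed.on (initial_topology f).

(** Brouwer's theorem: a nonempty compact perfect space with a countable family of
    clopen sets that separates points is a Cantor space. The field [R] only
    serves as the range of an auxiliary pseudometric. *)
Lemma homeomorphic_cantor_space (R : realType) (X : topologicalType) (x0 : X)
    (U : nat -> set X) :
  compact [set: X] -> perfect_set [set: X] -> (forall n, clopen (U n)) ->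
  (forall x y, x <> y -> exists n, U n x /\ ~ U n y) ->
  homeomorphic X cantor_space.
Proof.
move=> cptX perfX clU sepU.
pose pX := HB.pack_for pointedType X (isPointed.Build X x0).
pose C := tree_of (fun=> bool).
have hC : hausdorff_space C.
  apply: (@hausdorff_product _ (fun=> discrete_topology bool)) => n.
  exact: discrete_hausdorff.
pose e (x : pX) : C := fun n => `[<U n x>].
have e_inj : injective e.
  move=> x y exy; apply: contrapT => /sepU[n [Unx]]; apply.
  have : e x n = e y n by rewrite exy.
  by rewrite /e (asboolT Unx) => /esym/asboolP.
(* [T] is [X] with the topology, a metrizable one, that makes [e] an embedding;
   it turns out to be the topology of [X]. *)
pose T := initial_topology e.
have cXT : continuous (id : X -> T).
  apply: continuous_comp_initial => x; apply/cvg_sup => i; move: x.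
  apply/(@continuousP _ (initial_topology (fun h : C => h i))) => A [B _ <-].
  rewrite openE => x /= Bx; rewrite /interior.
  have [Ux|NUx] := pselect (U i x).
    apply: (@filterS _ _ _ (U i)); last first.
      by apply: open_nbhs_nbhs; split => //; have [] := clU i.
    by move=> y Uy; move: Bx; rewrite /= /e (asboolT Ux) (asboolT Uy).
  apply: (@filterS _ _ _ (~` U i)); last first.
    by apply: open_nbhs_nbhs; split => //; apply: closed_openC; have [] := clU i.
  by move=> y Uy; move: Bx; rewrite /= /e (asboolF NUx) (asboolF Uy).
have hT : hausdorff_space T.
  apply: (@injective_continuous_hausdorff T C e) => //; exact: initial_continuous.
have cTX : continuous (id : T -> X).
  by apply: (compact_hausdorff_inverse_continuous cptX hT cXT).
have cantorT : cantor_like T.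
  split => //.
  - apply/perfectTP_ex => V oV V0; apply: (iffLR perfectTP_ex perfX) => //.
    by move/continuousP: cXT; apply.
  - have := @continuous_compact X T id [set: X]; rewrite image_id; apply => //.
    exact: continuous_subspaceT.
  - move=> x y /eqP /sepU[n [Unx Uny]]; exists (U n); split => //.
    have [oU cU] := clU n; split.
      by move/continuousP: cTX; apply.
    by move/continuous_closedP: cTX; apply.
have [f [cf _]] := @homeomorphism_cantor_like R _ cantorT.
have [g fK gK] : bijective f by rewrite -setTT_bijective; exact: bij.
exists g, f; split => //; last by move=> c; exact: (continuous_comp (cf c) (cTX _)).
apply: (@compact_hausdorff_inverse_continuous _ _ (f : cantor_space -> X)) => //.
- exact: cantor_space_compact.
- exact: (@injective_continuous_hausdorff X T id).
- by move=> c; exact: (continuous_comp (cf c) (cTX _)).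
Qed.

(** * The space of additive orders *)

Lemma compact_set_type (X : topologicalType) (A : set X) :
  compact A -> compact [set: set_type A].
Proof.
move=> cptA F PF _.
have [|p [Ap clp]] := cptA (set_val @ F) (fmap_proper_filter _ _).
  by apply: (@filterS _ F _ setT) => [x _|]; [exact: set_valP|exact: filterT].
exists (SigSub (mem_set Ap)); split => // P Q FP [_ [[V oV <-] /= Vp VQ]].
have [] := clp (set_val @` P) V.
- by apply: (@filterS _ F _ P) => // x Px; exists x.
- exact: open_nbhs_nbhs.
by move=> _ [[x Px <-] Vx]; exists x; split => //; exact: VQ.
Qed.

Section AdditiveOrders.
Variables (R : realType) (r : nat).
Notation orders := (set_type (@additive_orders R r)).
Implicit Types (m : 'rV[int]_r) (x y : orders).

(** The orders in which [m] is nonnegative. *)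
Definition order_nonneg_at m : set orders := set_val @^-1` (@nonneg_at R r m).

Lemma orders_anti x m : preceq (set_val x) 0 m -> preceq (set_val x) 0 (- m) ->
  m = 0.
Proof.
by have /antisymmetricP := set_valP x; apply.
Qed.

Lemma clopen_order_nonneg_at m : clopen (order_nonneg_at m).
Proof.
have opn n : open (order_nonneg_at n).
  by exists (nonneg_at n) => //; exact: open_nonneg_at.
split => //; have [->|/eqP m0] := eqVneq m 0.
  rewrite [X in closed X](_ : _ = setT); first exact: closedT.
  by apply/seteqP; split => // x _; exact: preceq_refl.
rewrite [X in closed X](_ : _ = ~` order_nonneg_at (- m)); first exact: open_closedC.
apply/seteqP; split => x /= xm; first by move=> xNm; exact/m0/(orders_anti xm).
by have /orP[//|/xm] := preceq0_total (set_val x) m.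
Qed.

Lemma order_nonneg_at_separates x y : x <> y ->
  exists m, order_nonneg_at m x /\ ~ order_nonneg_at m y.
Proof.
move=> xy; apply: contrapT => nosep; apply: xy; apply: val_inj.
apply: additive_preorder_ext => m.
have sub n : preceq (set_val x) 0 n -> preceq (set_val y) 0 n.
  by move=> xn; apply: contrapT => yn; apply: nosep; exists n.
apply/idP/idP => [/sub//|ym].
have /orP[//|xNm] := preceq0_total (set_val x) m.
by rewrite (orders_anti ym (sub _ xNm)) preceq_refl.
Qed.

Lemma perfect_additive_orders : (2 <= r)%N -> perfect_set [set: orders].
Proof.
move=> r2; apply/perfectTP_ex => _ [V oV <-] [x /= Vx].
have /ZR_nbhsP[B Bx BV] : nbhs (set_val x) V by exact: open_nbhs_nbhs.
have [w [w_anti Bw wx]] := order_not_isolated r2 (set_valP x) Bx.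
exists x, (SigSub (mem_set w_anti : w \in @additive_orders R r)); split => //.
  exact: BV.
by apply/eqP => /(congr1 set_val)/esym.
Qed.

End AdditiveOrders.

Theorem proposition2 (R : realType) (r : nat) (hr : (2 <= r)%N) :
  [/\ cover_compact [set: ZR R r],
      closed (@additive_orders R r) &
      homeomorphic (set_type (@additive_orders R r)) cantor_space].
Proof.
split; [by rewrite -compact_cover; exact: ZR_compact|exact: closed_additive_orders|].
have [w0 w0_anti] := exists_additive_order r.
pose x0 : set_type (@additive_orders R r) :=
  SigSub (mem_set w0_anti : w0 \in @additive_orders R r).
pose U n := @order_nonneg_at R r (odflt 0 (unpickle n)).
apply: (@homeomorphic_cantor_space R (set_type (@additive_orders R r)) x0 U).
- apply: compact_set_type; apply: subclosed_compact (@ZR_compact R r) _ => //.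
  exact: closed_additive_orders.
- exact: perfect_additive_orders.
- by move=> n; exact: clopen_order_nonneg_at.
- move=> x y /order_nonneg_at_separates[m xy].
  by exists (pickle m); rewrite /U pickleK.
Qed.
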